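(* Let $G$ be a finite, non-abelian group with a cyclic-by-abelian factorization $G = AN$, i.e. $N \trianglelefteq G$ is a cyclic normal subgroup, $A \leq G$ is an abelian subgroup, and $G = AN$. Let $\Gamma$ be the commuting graph of $G$. Then the following statements hold. (a) The graph $\Gamma$ is connected if and only if there exists a non-central $g \in G$ such that the centralizer $C_G(g)$ is non-abelian. (b) If $\Gamma$ is connected, then its diameter is at most four. (c) If $\Gamma$ is disconnected, then it is the disjoint union of one complete graph on $(|G'| - 1)\,|Z(G)|$ vertices and $|G'|$ complete graphs, each on $[G : G'] - |Z(G)|$ vertices.
   Context: A finite group $G$ has a cyclic-by-abelian factorization if there exist a normal cyclic subgroup $N \trianglelefteq G$ and an abelian subgroup $A \leq G$ such that $G = AN$ (the intersection $A \cap N$ need not be trivial). The commuting graph of a non-abelian finite group $G$ is the simple graph with vertex set $\{g \in G \mid g \notin Z(G)\}$ in which two (distinct) vertices $u, v$ are adjacent if and only if $u$ and $v$ commute in $G$. Notation: $Z(G)$ is the center of $G$, $G'$ is the commutator subgroup of $G$, and $C_G(g)$ is the centralizer of $g$ in $G$. *)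

(* Defs.v *)
From mathcomp Require Import all_boot all_fingroup all_solvable.

Set Implicit Arguments.
Unset Strict Implicit.
Unset Printing Implicit Defensive.

Record sgraph := SGraph {
  svertex :> finType;
  sedge : rel svertex;
  sedge_sym : symmetric sedge;
  sedge_irr : irreflexive sedge }.

Definition sconnected (H : sgraph) : bool :=
  [forall x : H, forall y : H, connect (@sedge H) x y].

Definition has_walk (H : sgraph) (n : nat) (x y : H) : bool :=
  [exists p : n.-tuple H, path (@sedge H) x p && (last x p == y)].

(* The least length of a walk from x to y. A shortest walk has length < #|H|,
   so the search below always succeeds when x and y are connected; otherwise
   it returns the default value #|H|. *)
Definition sdist (H : sgraph) (x y : H) : nat :=
  find (fun n => has_walk n x y) (iota 0 #|H|).

(* Meaningful for connected graphs only, see sdist. *)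
Definition diameter (H : sgraph) : nat :=
  \max_(x : H) \max_(y : H) sdist x y.

Definition sgraph_iso (H K : sgraph) : Prop :=
  exists2 f : H -> K, bijective f &
    forall x y : H, sedge (f x) (f y) = sedge x y.

Section Complete.

Variable n : nat.

Definition complete_rel : rel 'I_n := [rel i j | i != j].

Fact complete_sym : symmetric complete_rel.
Proof. by move=> i j; rewrite /complete_rel /= eq_sym. Qed.

Fact complete_irr : irreflexive complete_rel.
Proof. by move=> i; rewrite /complete_rel /= eqxx. Qed.

Definition complete_graph : sgraph := SGraph complete_sym complete_irr.

End Complete.

Section DisjointUnion.

Variables (I : finType) (F : I -> sgraph).

(* tagged_as u v is the second component of v, cast to F (tag u), when the
   tags of u and v agree. *)
Definition dunion_rel : rel {i : I & F i} :=
  [rel u v | (tag u == tag v) && sedge (tagged u) (tagged_as u v)].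

Fact dunion_sym : symmetric dunion_rel.
Proof.
move=> [i x] [j y]; rewrite /dunion_rel /= eq_sym.
by have [eq_ji | //] := eqVneq j i; subst j; rewrite !tagged_asE sedge_sym.
Qed.

Fact dunion_irr : irreflexive dunion_rel.
Proof. by move=> [i x]; rewrite /dunion_rel /= tagged_asE sedge_irr andbF. Qed.

Definition disjoint_union : sgraph := SGraph dunion_sym dunion_irr.

End DisjointUnion.

Section Commuting.

Local Open Scope group_scope.

Variables (gT : finGroupType) (G : {group gT}).

Definition commuting_vertex : finType := {x : gT | x \in G :\: 'Z(G)}.

Definition commuting_rel : rel commuting_vertex :=
  [rel u v | (u != v) && (val u * val v == val v * val u)].

Fact commuting_sym : symmetric commuting_rel.
Proof. by move=> u v; rewrite /commuting_rel /= eq_sym [X in _ && X]eq_sym. Qed.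

Fact commuting_irr : irreflexive commuting_rel.
Proof. by move=> u; rewrite /commuting_rel /= eqxx. Qed.

Definition commuting_graph : sgraph := SGraph commuting_sym commuting_irr.

End Commuting.

(* Main.v *)
Require Import Defs.
From mathcomp Require Import all_boot all_fingroup all_solvable.

(* Put Z = Z(G) and K = C_G(N) = Z N, an abelian subgroup. As N is cyclic, |G'|
   divides |N : N :&: Z|. If x in G satisfies C_N(x) <= Z, then the class of x
   under N already has |N : N :&: Z| elements, so it is the coset x G' and also
   the class under G; hence |G : C_G(x)| = |G'| and G = C_G(x) N, and C_G(x)
   turns out to be abelian, so that it can replace A.
   If some b outside K commutes with a noncentral n in N, every vertex is at
   distance at most 2 from n: when C_N(x) <= Z, write b = c m with c in C_G(x)
   and m in N, and go from x to c to n. Otherwise all centralizers of noncentral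
   elements are abelian, commuting is an equivalence relation on G minus Z, and
   its classes are K minus Z and the sets C_G(x) minus Z for x outside K, whose
   number is found by counting G minus K. *)

Set Implicit Arguments.
Unset Strict Implicit.
Unset Printing Implicit Defensive.

(** * Walks with repeated vertices; isomorphisms onto disjoint unions *)

Section Graphs.

Variable H : sgraph.

Lemma sdist_le n (x y : H) : has_walk n x y -> sdist x y <= n.
Proof.
move=> walk; rewrite leqNgt; apply/negP=> lt_n.
have lt_nH : n < #|H|.
  by rewrite (leq_trans lt_n) // -[leqRHS](size_iota 0) find_size.
by have := before_find 0 lt_n; rewrite nth_iota // walk.
Qed.

(** Deleting stationary steps never lengthens a walk. Walks through given vertices can thus be built
    without checking that consecutive ones differ. *)
Lemma lazy_walk (x : H) p : path (fun u v => (u == v) || sedge u v) x p ->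
  exists q, [/\ size q <= size p, path (@sedge H) x q & last x q = last x p].
Proof.
elim: p x => [|z p IHp] x /=; first by exists [::].
case/andP=> /orP[/eqP-> | xz] /IHp[q [le_qp path_q last_q]].
  by exists q; split=> //; apply: leqW.
by exists (z :: q); rewrite /= xz.
Qed.

Lemma lazy_walk_connected k :
    (forall x y : H, exists2 p, size p <= k &
       path (fun u v => (u == v) || sedge u v) x p /\ last x p = y) ->
  sconnected H /\ diameter H <= k.
Proof.
move=> walk; have {}walk (x y : H) : exists q,
    [/\ size q <= k, path (@sedge H) x q & last x q = y].
  have [p le_pk [/lazy_walk[q [le_qp path_q last_q]] <-]] := walk x y.
  by exists q; rewrite (leq_trans le_qp).
split.
  apply/forallP=> x; apply/forallP=> y; have [q [_ path_q last_q]] := walk x y.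
  by apply/connectP; exists q.
apply/bigmax_leqP=> x _; apply/bigmax_leqP=> y _.
have [q [le_qk path_q last_q]] := walk x y.
apply: leq_trans le_qk; apply: sdist_le; apply/existsP; exists (in_tuple q).
by rewrite path_q last_q /=.
Qed.

(** The fibre of [c] over [i] and the graph [F i] are both complete, so any bijection between them
    preserves edges; matching enumerations supply one. *)
Lemma sgraph_iso_disjoint_union (I : finType) (F : I -> sgraph) (c : H -> I) :
    (forall i, #|{: {x : H | c x == i}}| = #|F i|) ->
    (forall i (u v : F i), sedge u v = (u != v)) ->
    (forall x y : H, sedge x y = (x != y) && (c x == c y)) ->
  sgraph_iso H (disjoint_union F).
Proof.
move=> cardF completeF edgeH.
pose h i (v : {x : H | c x == i}) : F i :=
  enum_val (cast_ord (cardF i) (enum_rank v)).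
pose h' i (y : F i) : {x : H | c x == i} :=
  enum_val (cast_ord (esym (cardF i)) (enum_rank y)).
have hK i : cancel (h i) (h' i).
  by move=> v; rewrite /h /h' enum_valK cast_ordK enum_rankK.
have h'K i : cancel (h' i) (h i).
  by move=> y; rewrite /h /h' enum_valK cast_ordKV enum_rankK.
pose f x : {i : I & F i} := Tagged F (h (c x) (exist _ x (eqxx (c x)))).
(* The arbitrary label [i] can be replaced by [c x], which resolves the type dependency. *)
have f_val i (v : {x | c x == i}) : f (val v) = Tagged F (h i v).
  case: v => x cx; have def_i := eqP cx; subst i; rewrite /f /=.
  by rewrite (bool_irrelevance cx (eqxx _)).
have bij_f : bijective f.
  exists (fun u => val (h' (tag u) (tagged u))) => [x | [i y]] /=.
    by rewrite /f /= hK.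
  by rewrite f_val h'K.
exists f => // x y; rewrite edgeH -(inj_eq (bij_inj bij_f)) [LHS]/=.
rewrite [f y]/f [f x]/f /= -tag_eqE /tag_eq /dunion_rel /=.
by rewrite completeF; case: (c x == c y); rewrite ?andbF ?andbT.
Qed.

End Graphs.

Local Open Scope group_scope.

(** The product equals [b * c * (m ^+ (s + t) * w ^+ (s * t))], which is symmetric in the two
    factors. *)
Lemma commute_twist (hT : finGroupType) (b c m w : hT) (s t : nat) :
    commute b c -> commute m w -> m ^ b = m * w ^+ s -> m ^ c = m * w ^+ t ->
  commute (b * m ^+ s) (c * m ^+ t).
Proof.
move=> cbc cmw mb mc.
have twist u v i j : m ^ v = m * w ^+ j ->
    u * m ^+ i * (v * m ^+ j) = u * v * (m ^+ (i + j) * w ^+ (i * j)).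
  move=> mv; have mX : m ^+ i * v = v * (m ^+ i * w ^+ (i * j)).
    rewrite conjgC conjXg mv expgMn -?expgM ?[(j * i)%N]mulnC //.
    exact: commuteX.
  have cX : commute (w ^+ (i * j)) (m ^+ j) by apply/commute_sym/commuteX2.
  by rewrite mulgA -(mulgA u) mX -!mulgA cX expgD !mulgA.
by rewrite /commute !twist // cbc mulnC addnC.
Qed.

(** * Groups whose noncentral elements have abelian centralizers *)

Section AbelianCentralizers.

Variables (gT : finGroupType) (G : {group gT}).
Hypothesis abC : {in G :\: 'Z(G), forall x, abelian 'C_G[x]}.

(** If [x] and [y] commute, all of the abelian group ['C_G[x]] commutes with its member [y], and
    symmetrically. So commuting is an equivalence relation on vertices. *)
Lemma eq_cent1_abelian x y : x \in G :\: 'Z(G) -> y \in G :\: 'Z(G) ->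
  ('C_G[x] == 'C_G[y]) = (x * y == y * x).
Proof.
move=> GZx GZy; have [[Gx _] [Gy _]] := (setDP GZx, setDP GZy).
apply/eqP/eqP=> [eqC | cxy].
  have : x \in 'C_G[y] by rewrite -eqC; apply/setIP; split=> //; apply/cent1P.
  by case/setIP=> _ /cent1P.
have sub u v : u \in G :\: 'Z(G) -> v \in G -> commute v u ->
    'C_G[u] \subset 'C_G[v].
  move=> GZu Gv cvu; rewrite subsetI subsetIl; apply/subsetP=> w Cw; apply/cent1P.
  apply: (centsP (abC GZu)) => //.
  by apply/setIP; split=> //; apply/cent1P.
by apply/eqP; rewrite eqEsubset !sub.
Qed.

(** The centralizer is constant along a walk, so any two noncentral elements commute. *)
Lemma connected_commuting_abelian : sconnected (commuting_graph G) -> abelian G.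
Proof.
move=> /forallP connG; apply/centsP=> x Gx y Gy.
have [/centerP[_ Zx] | notZx] := boolP (x \in 'Z(G)); first exact: Zx.
have [/centerP[_ Zy] | notZy] := boolP (y \in 'Z(G)).
  exact/commute_sym/Zy.
have [GZx GZy] : x \in G :\: 'Z(G) /\ y \in G :\: 'Z(G) by split; apply/setDP.
have /forallP/(_ (Sub y GZy))/connectP[p path_p last_p] := connG (Sub x GZx).
apply/eqP; rewrite -eq_cent1_abelian //.
have -> : y = val (last (Sub x GZx : commuting_graph G) p) by rewrite -last_p.
have {1}-> : x = val (Sub x GZx : commuting_graph G) by [].
elim: p (Sub x GZx : commuting_graph G) path_p {last_p} => [|w p IHp] u //=.
case/andP=> /andP[_ cuw] /IHp/eqP<-.
by rewrite eq_cent1_abelian ?(valP u) ?(valP w).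
Qed.

End AbelianCentralizers.

Lemma card_commuting_vertex_in (gT : finGroupType) (G : {group gT}) (S : {set gT})
    (Q : pred (commuting_graph G)) :
    S \subset G :\: 'Z(G) -> (forall u, Q u = (val u \in S)) ->
  #|{: {u : commuting_graph G | Q u}}| = #|S|.
Proof.
move=> sSG QS; rewrite card_sig -(card_image val_inj); apply: eq_card => x.
apply/imageP/idP=> [[u Qu ->] | Sx]; first by rewrite -QS.
by exists (Sub x (subsetP sSG _ Sx)); rewrite // inE QS.
Qed.

(** * The centralizer of [N] and the order of the commutator subgroup *)

Section CyclicByAbelian.

Variables (gT : finGroupType) (G A N : {group gT}).
Hypotheses (nsNG : N <| G) (cycN : cyclic N).
Hypotheses (sAG : A \subset G) (abA : abelian A) (defG : A * N = G).

Let sNG : N \subset G := normal_sub nsNG.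
Let abN : abelian N := cyclic_abelian cycN.

(** If [a * n] centralizes [N], then [a] centralizes both [N] and [A], hence is central. *)
Lemma cent_cyclic_normal : 'C_G(N) = 'Z(G) * N.
Proof.
apply/eqP; rewrite eqEsubset mulG_subG; apply/and3P; split.
- apply/subsetP=> g /setIP[]; rewrite -{1}defG => /mulsgP[a n Aa Nn ->] cNan.
  apply: mem_mulg => //; rewrite inE (subsetP sAG) //= -defG centM inE.
  rewrite (subsetP abA) //= -(mulgK n a) groupM // groupV.
  exact: subsetP abN _ Nn.
- by rewrite subsetI subIset ?subxx // subIset // centS ?orbT.
- by rewrite subsetI sNG.
Qed.

Lemma abelian_cent_cyclic_normal : abelian 'C_G(N).
Proof.
rewrite cent_cyclic_normal abelianM center_abelian abN /=.
by rewrite centsC subIset // centS ?orbT.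
Qed.

Lemma commg_normal n g : n \in N -> g \in G -> [~ n, g] \in N.
Proof.
move=> Nn Gg; rewrite commgEl groupM ?groupV // memJ_norm //.
exact: subsetP (normal_norm nsNG) _ Gg.
Qed.

Lemma commgX_normal n g k :
  n \in N -> g \in G -> [~ n ^+ k, g] = [~ n, g] ^+ k.
Proof.
by move=> Nn Gg; apply: commXg; apply: (centsP abN); rewrite ?commg_normal.
Qed.

(** The index d is that of [N :&: 'Z(G)] in [N]. For a generator [n0] of [N], [n0, g]^d = [n0^d, g]
    = 1, so these commutators lie in the subgroup [H] of [N] of order d, and G/H is abelian. *)
Lemma card_der1_dvd : #|G^`(1)| %| #|N : 'Z(G)|.
Proof.
have /cyclicP[n0 defN] := cycN; have Nn0 : n0 \in N by rewrite defN cycle_id.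
set d := #|N : _|; pose e := #|N :&: 'Z(G)|.
have de : #|N| = (e * d)%N by rewrite /d LagrangeI.
pose H := <[n0 ^+ e]>%G.
have sHN : H \subset N by rewrite cycle_subG groupX.
have oH : #|H| = d.
  by rewrite -[LHS]/#[_] orderXdiv /order -defN de ?dvdn_mulr // mulKn ?cardG_gt0.
have Zn0d : n0 ^+ d \in 'Z(G).
  (* [n0 ^+ d] has order [e], and a cyclic group has one subgroup of each order. *)
  have : <[n0 ^+ d]>%G \subset (N :&: 'Z(G))%G.
    rewrite -(cardSg_cyclic cycN) ?subsetIl ?cycle_subG ?groupX //=.
    rewrite -[#|<[_]>|]/#[_] orderXdiv /order -defN de ?dvdn_mull // mulnK //.
    exact: indexg_gt0.
  by rewrite cycle_subG => /setIP[].
have nHG : H <| G by apply: char_normal_trans nsNG; rewrite sub_cyclic_char.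
have com0 g : g \in G -> [~ n0, g] \in H.
  move=> Gg; have Nc := commg_normal Nn0 Gg.
  have : <[[~ n0, g]]>%G \subset H.
    rewrite -(cardSg_cyclic cycN _ sHN) ?cycle_subG // oH order_dvdn.
    rewrite -commgX_normal //; apply/commgP.
    by case/centerP: Zn0d => _ /(_ _ Gg).
  by rewrite cycle_subG.
have sG'H : G^`(1) \subset H.
  apply: der1_min; first exact: normal_norm.
  have nHA : A \subset 'N(H) by rewrite (subset_trans sAG) ?normal_norm.
  have nHN : N \subset 'N(H) by rewrite (subset_trans sNG) ?normal_norm.
  rewrite -defG quotientMl // abelianM !quotient_abelian //= quotient_cents2 //.
  rewrite gen_subG; apply/subsetP=> _ /imset2P[n a Nn Aa ->].
  move: Nn; rewrite defN => /cycleP[i ->].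
  have Ga := subsetP sAG _ Aa.
  by rewrite commgX_normal ?groupX ?com0.
by rewrite -oH cardSg.
Qed.

(** * Elements whose centralizer in [N] is central *)

Section SmallCentralizer.

Variable x : gT.
Hypotheses (Gx : x \in G) (sCZ : 'C_N[x] \subset 'Z(G)).

Lemma subcent1_normalE : 'C_N[x] = N :&: 'Z(G).
Proof.
apply/eqP; rewrite eqEsubset subsetI subsetIl sCZ subsetI subsetIl /=.
by apply/subsetP=> z /setIP[_ /centerP[_ Zz]]; apply/cent1P; apply: Zz.
Qed.

(** Since x^n = x [x, n], the class lies in the coset; it has |N : N :&: Z(G)| elements, which is at
    least |G'|. *)
Lemma class_normalE : x ^: N = x *: G^`(1).
Proof.
apply/eqP; rewrite eqEcard; apply/andP; split.
  apply/subsetP=> _ /imsetP[n Nn ->]; rewrite conjg_mulR mem_lcoset mulKg.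
  by rewrite mem_commg // (subsetP sNG).
rewrite card_lcoset -index_cent1 subcent1_normalE indexgI.
by rewrite dvdn_leq ?card_der1_dvd.
Qed.

Lemma card_der1 : #|G^`(1)| = #|N : 'Z(G)|.
Proof.
by rewrite -(card_lcoset _ x) -class_normalE -index_cent1 subcent1_normalE indexgI.
Qed.

Lemma classE_normal : x ^: G = x ^: N.
Proof.
apply/eqP; rewrite eqEsubset (classS _ sNG) andbT class_normalE.
apply/subsetP=> _ /imsetP[n Nn ->]; rewrite conjg_mulR mem_lcoset mulKg.
by rewrite mem_commg.
Qed.

Lemma der1_commg y : y \in G^`(1) -> exists2 n, n \in N & y = [~ n, x].
Proof.
move=> G'y; have: x * y^-1 \in x ^: N.
  by rewrite class_normalE mem_lcoset mulKg groupV.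
case/imsetP=> n Nn; rewrite conjg_mulR => /mulgI yV.
by exists n; rewrite // -(invgK y) yV invg_comm.
Qed.

Lemma card_subcent1 : #|G : 'C_G[x]| = #|G^`(1)|.
Proof. by rewrite index_cent1 classE_normal class_normalE card_lcoset. Qed.

(** Frattini argument: [N] is already transitive on the [G]-class of [x]. *)
Lemma mul_cent1_normal : 'C_G[x] * N = G.
Proof.
apply/eqP; rewrite eqEsubset mulG_subG subsetIl sNG; apply/subsetP=> g Gg.
have : x ^ g \in x ^: N by rewrite -classE_normal imset_f.
case/imsetP=> n Nn xg; rewrite -(mulgKV n g) mem_mulg //; apply/setIP; split.
  by rewrite groupM ?groupV // (subsetP sNG).
by apply/cent1P/commute_sym/commgP/conjg_fixP; rewrite conjgM xg conjgK.
Qed.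

End SmallCentralizer.

(* Write x = a m with a in A and m in N. As G' = [N, a], every b in A acts on N
   through a power of the action of a: [n, b] = [n, a] ^ s for all n in N. Then
   b m^s commutes with x, and 'C_G[x] consists of such elements up to 'Z(G). *)
Lemma abelian_cent1 x : x \in G -> 'C_N[x] \subset 'Z(G) -> abelian 'C_G[x].
Proof.
move=> Gx sCZ; have: x \in A * N by rewrite defG.
case/mulsgP=> a m Aa Nm def_x; have Ga := subsetP sAG _ Aa.
have sCa : 'C_N[a] \subset 'Z(G).
  apply: subset_trans sCZ; apply/subsetP=> n /setIP[Nn /cent1P na].
  apply/setIP; split=> //; apply/cent1P; rewrite def_x.
  by apply: commuteM => //; apply: (centsP abN).
have cmw : commute m [~ m, a] by apply: (centsP abN); rewrite ?commg_normal.
(* For a generator [n0] of [N], [n0, b] lies in G', so it is [n0^s, a] for some s; this s also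
   serves for [m], a power of [n0]. *)
have powA b : b \in A -> exists s, m ^ b = m * [~ m, a] ^+ s.
  move=> Ab; have Gb := subsetP sAG _ Ab.
  have /cyclicP[n0 defN] := cycN; have Nn0 : n0 \in N by rewrite defN cycle_id.
  have /(der1_commg Ga sCa)[k] : [~ n0, b] \in G^`(1).
    by rewrite mem_commg // (subsetP sNG).
  rewrite {1}defN => /cycleP[s ->]; rewrite commgX_normal // => n0b.
  move: Nm; rewrite {1}defN => /cycleP[i ->]; exists s.
  by rewrite conjg_mulR !commgX_normal // n0b -!expgM mulnC.
(* So [x = a * m] itself has the form [b * m ^+ s], with b = a and s = 1. *)
have mema : m ^ a = m * [~ m, a] ^+ 1 by rewrite conjg_mulR.
have decomp c : c \in 'C_G[x] -> exists b s z,
    [/\ b \in A, m ^ b = m * [~ m, a] ^+ s, z \in 'Z(G) & c = b * m ^+ s * z].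
  case/setIP; rewrite -{1}defG => /mulsgP[b m' Ab Nm' ->] /cent1P cx.
  have [s mb] := powA b Ab.
  exists b, s, (m ^- s * m'); split=> //; last by rewrite !mulgA mulgK.
  apply: (subsetP sCZ); apply/setIP; split.
    by rewrite groupM ?groupV ?groupX.
  have cbx : commute (b * m ^+ s) x.
    rewrite def_x -[m in a * m]expg1; apply: commute_twist mb mema => //.
    exact: (centsP abA).
  have -> : m ^- s * m' = (b * m ^+ s)^-1 * (b * m').
    by rewrite invMg !mulgA mulgKV.
  apply/cent1P/commute_sym/commuteM; last exact/commute_sym.
  exact/commuteV/commute_sym.
apply/centsP=> _ /decomp[b [s [z [Ab mb /centerP[Gz Zz] ->]]]].
move=> c Cc; have Gc : c \in G by case/setIP: Cc.
apply/commute_sym/commuteM; last exact/commute_sym/Zz.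
case/decomp: Cc Gc => b' [t [z' [Ab' mb' /centerP[Gz' Zz'] ->]]] _.
apply/commute_sym/commuteM.
  by apply: commute_twist mb mb' => //; apply: (centsP abA).
apply/commute_sym/Zz'.
by rewrite groupM ?groupX ?(subsetP sAG _ Ab) ?(subsetP sNG).
Qed.

Lemma card_cent_normal x :
  x \in G -> 'C_N[x] \subset 'Z(G) -> #|'C_G(N)| = (#|G^`(1)| * #|'Z(G)|)%N.
Proof.
move=> Gx sCZ; apply/eqP; rewrite -(eqn_pmul2r (cardG_gt0 (N :&: 'Z(G)))).
rewrite (card_der1 Gx sCZ) cent_cyclic_normal /= {1}setIC -mul_cardG.
by apply/eqP; rewrite -(LagrangeI N 'Z(G)) [LHS]mulnC [RHS]mulnC mulnA.
Qed.

(** The dividing line of the proof: for non-abelian [G] it turns out to be equivalent to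
    disconnectedness of the commuting graph. *)
Definition small_centralizers :=
  [forall x in G :\: 'C(N), 'C_N[x] \subset 'Z(G)].

Lemma common_vertex_near : ~~ small_centralizers ->
  exists2 n, n \in G :\: 'Z(G) &
    forall x, x \in G :\: 'Z(G) ->
      exists y, [/\ y \in G :\: 'Z(G), commute x y & commute y n].
Proof.
case/forall_inPn=> b /setDP[Gb notCb] /subsetPn[n /setIP[Nn /cent1P nb] notZn].
have Gn := subsetP sNG _ Nn.
exists n => [|x /setDP[Gx notZx]]; first by rewrite inE notZn.
have [Cx | notCx] := boolP (x \in 'C(N)).
  by exists x; split=> //; [apply/setDP | apply: (centP Cx)].
have [sCZ | /subsetPn[y /setIP[Ny /cent1P yx] notZy]] :=
    boolP ('C_N[x] \subset 'Z(G)); last first.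
  exists y; split; first by rewrite inE notZy (subsetP sNG).
    exact/commute_sym.
  exact: (centsP abN).
move: (Gb); rewrite -{1}(mul_cent1_normal Gx sCZ).
case/mulsgP=> c m /setIP[Gc /cent1P cx] Nm def_b; exists c; split.
(* Were [c] central, [b = c * m] would centralize [N]. *)
- rewrite inE Gc andbT; apply: contra notCb => /setIP[_ Zc].
  rewrite def_b groupM //; last exact: (subsetP abN).
  exact: subsetP (centS sNG) _ Zc.
- exact/commute_sym.
- have -> : c = b * m^-1 by rewrite def_b mulgK.
  apply/commute_sym/commuteM => //; apply: (centsP abN) => //.
  by rewrite groupV.
Qed.

(** * The disconnected case: components and their sizes *)

Section SmallCentralizers.

Hypothesis smallC : small_centralizers.

(** Write x = z n with z central and n in [N]. An element outside ['C(N)] commuting with [x] would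
    commute with n, making n and then [x] central. *)
Lemma cent1_noncentral_normal x :
  x \in G :\: 'Z(G) -> x \in 'C(N) -> 'C_G[x] = 'C_G(N).
Proof.
case/setDP=> Gx notZx Cx; have CGx : x \in 'C_G(N) by apply/setIP.
apply/eqP; rewrite eqEsubset andbC; apply/andP; split.
  rewrite subsetI subsetIl; apply/subsetP=> y Cy; apply/cent1P.
  exact: (centsP abelian_cent_cyclic_normal).
apply/subsetP=> y /setIP[Gy /cent1P yx]; apply/setIP; split=> //.
apply: contraR notZx => notCy.
have /(forall_inP smallC) sCZ : y \in G :\: 'C(N) by apply/setDP.
move: CGx; rewrite cent_cyclic_normal => /mulsgP[z n Zz Nn def_x].
rewrite def_x groupM // (subsetP sCZ) //; apply/setIP; split=> //; apply/cent1P.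
have -> : n = z^-1 * x by rewrite def_x mulKg.
apply/commute_sym/commuteM => //; apply/commuteV.
by case/centerP: Zz => _ Zz; apply/commute_sym/Zz.
Qed.

Lemma abelian_cent1_noncentral x : x \in G :\: 'Z(G) -> abelian 'C_G[x].
Proof.
move=> GZx; have [Cx | notCx] := boolP (x \in 'C(N)).
  by rewrite cent1_noncentral_normal ?abelian_cent_cyclic_normal.
have [Gx _] := setDP GZx; apply: abelian_cent1 => //.
by apply: (forall_inP smallC); apply/setDP.
Qed.

Hypothesis nonabG : ~~ abelian G.

Let P := [set 'C_G[x] | x in G :\: 'C(N)].

Lemma setD_cent_noncentral x : x \in G :\: 'C(N) -> x \in G :\: 'Z(G).
Proof.
case/setDP=> Gx notCx; apply/setDP; split=> //; apply: contra notCx.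
by case/setIP=> _; apply: (subsetP (centS sNG)).
Qed.

Lemma setD_cent_neq0 : exists x, x \in G :\: 'C(N).
Proof.
apply/set0Pn; apply: contra nonabG; rewrite setD_eq0 => sGC.
by rewrite -(setIidPl sGC) abelian_cent_cyclic_normal.
Qed.

Lemma card_cent1 x : x \in G :\: 'C(N) -> #|'C_G[x]| = #|G : G^`(1)|.
Proof.
move=> GCx; have sCZ := forall_inP smallC _ GCx; have [Gx _] := setDP GCx.
apply/eqP; rewrite -(eqn_pmul2r (cardG_gt0 G^`(1))) -{1}(card_subcent1 Gx sCZ).
by rewrite Lagrange ?subsetIl // mulnC Lagrange ?der_sub.
Qed.

Lemma cent1_fibre x : x \in G :\: 'C(N) ->
  [set y in G :\: 'Z(G) | 'C_G[y] == 'C_G[x]] = 'C_G[x] :\: 'Z(G).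
Proof.
move=> GCx; have GZx := setD_cent_noncentral GCx; apply/setP=> y.
rewrite inE; apply/andP/setDP=> [[GZy] | [/setIP[Gy /cent1P cyx] notZy]].
  rewrite (eq_cent1_abelian abelian_cent1_noncentral) // => /eqP cyx.
  have [Gy notZy] := setDP GZy.
  by split=> //; apply/setIP; split=> //; apply/cent1P.
have GZy : y \in G :\: 'Z(G) by apply/setDP.
by split=> //; rewrite (eq_cent1_abelian abelian_cent1_noncentral) //; apply/eqP.
Qed.

Lemma card_cent1_noncentral x : x \in G :\: 'C(N) ->
  #|'C_G[x] :\: 'Z(G)| = (#|G : G^`(1)| - #|'Z(G)|)%N.
Proof.
move=> GCx; rewrite cardsD (card_cent1 GCx); congr (_ - #|pred_of_set _|)%N.
apply/setIidPr; rewrite subsetI subIset ?subxx //=.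
apply/subsetP=> z /centerP[_ Zz]; apply/cent1P; apply: Zz.
by case/setDP: GCx.
Qed.

Lemma card_cent_noncentral :
  #|'C_G(N) :\: 'Z(G)| = ((#|G^`(1)| - 1) * #|'Z(G)|)%N.
Proof.
have [x GCx] := setD_cent_neq0; have [Gx _] := setDP GCx.
rewrite cardsD (card_cent_normal Gx (forall_inP smallC _ GCx)) mulnBl mul1n.
congr (_ - #|pred_of_set _|)%N; apply/setIidPr.
rewrite subsetI subIset ?subxx //=.
by rewrite subIset // centS ?orbT.
Qed.

(** Otherwise some [y] outside ['C(N)] would have centralizer ['C_G(N)], which contains [y]. *)
Lemma cent1_notin_cent1s x : x \in 'C(N) -> x \in G :\: 'Z(G) -> 'C_G[x] \notin P.
Proof.
move=> Cx GZx; apply/imsetP=> -[y GCy]; rewrite cent1_noncentral_normal // => eqC.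
have [Gy /negP[]] := setDP GCy; suff /setIP[] : y \in 'C_G(N) by [].
by rewrite eqC; apply/setIP; split=> //; apply/cent1P.
Qed.

(** Equality of centralizers partitions [G :\: 'C(N)] into blocks of size [q], while its order is
    |G| - |G'| |Z(G)| = |G'| q. *)
Lemma card_cent1s : #|P| = #|G^`(1)|.
Proof.
have [x GCx] := setD_cent_neq0; have [Gx _] := setDP GCx.
set q := (#|G : G^`(1)| - #|'Z(G)|)%N.
(* Positivity allows [q] to be cancelled; [x] itself lies in its block. *)
have q_gt0 : 0 < q.
  rewrite /q -(card_cent1_noncentral GCx); apply/card_gt0P; exists x.
  have [_ notZx] := setDP (setD_cent_noncentral GCx).
  by apply/setDP; split=> //; apply/setIP; split=> //; apply/cent1P.
have cardGC : #|G :\: 'C(N)| = (#|G^`(1)| * q)%N.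
  rewrite cardsD (card_cent_normal Gx (forall_inP smallC _ GCx)) mulnBr.
  by rewrite Lagrange ?der_sub.
apply/eqP; rewrite -(eqn_pmul2r q_gt0) -cardGC -sum_nat_const -sum1_card.
rewrite [X in _ == X](partition_big_imset (fun x => 'C_G[x])) /=.
apply/eqP/eq_bigr=> _ /imsetP[y GCy ->].
rewrite /q -(card_cent1_noncentral GCy) -(cent1_fibre GCy) -sum1_card.
apply: eq_bigl => z; rewrite [in LHS]inE; apply/andP/andP=> -[]; last first.
  by move=> GCz eqC; split=> //; apply: setD_cent_noncentral.
move=> GZz eqC; split=> //; have [Gz _] := setDP GZz; apply/setDP; split=> //.
apply: contraL (imset_f (fun x => 'C_G[x]) GCy) => Cz.
by rewrite -(eqP eqC) cent1_notin_cent1s.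
Qed.

Lemma commuting_graph_iso :
  sgraph_iso (commuting_graph G)
    (disjoint_union (fun i : option 'I_#|G^`(1)| =>
       if i is Some _
       then complete_graph (#|G : G^`(1)| - #|'Z(G)|)%N
       else complete_graph ((#|G^`(1)| - 1) * #|'Z(G)|)%N)).
Proof.
(* The centralizers of vertices in 'C(N) are not in P, so their index in enum P
   is #|P| = #|G^`(1)| and insub labels them None. *)
pose c (u : commuting_graph G) : option 'I_#|G^`(1)| :=
  insub (index 'C_G[val u] (enum P)).
have size_P : size (enum P) = #|G^`(1)| by rewrite -cardE card_cent1s.
have c_Some u i : (c u == Some i) = ('C_G[val u] == nth set0 (enum P) i).
  have lt_i : i < size (enum P) by rewrite size_P.
  rewrite /c; case: insubP => [k lt_k def_k | ge].
    apply/eqP/eqP=> [[<-] | eqC].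
      by rewrite def_k nth_index // -index_mem size_P.
    by congr Some; apply: val_inj; rewrite /= def_k eqC index_uniq ?enum_uniq.
  apply/esym/eqP=> eqC; case/negP: ge.
  by rewrite eqC index_uniq ?enum_uniq.
have memP (u : commuting_graph G) : val u \notin 'C(N) -> 'C_G[val u] \in P.
  move=> notCu; apply: imset_f; apply/setDP; split=> //.
  by case/setDP: (valP u).
have c_None u : (c u == None) = (val u \in 'C(N)).
  rewrite /c; have [Cu | notCu] := boolP (val u \in 'C(N)).
    rewrite insubF // -size_P index_mem mem_enum; apply: negbTE.
    exact: cent1_notin_cent1s (valP u).
  by case: insubP => // /negP[]; rewrite -size_P index_mem mem_enum memP.
apply: (sgraph_iso_disjoint_union (c := c)).
- case=> [i|] /=; rewrite card_ord.
    have: nth set0 (enum P) i \in P by rewrite -mem_enum mem_nth ?size_P.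
    case/imsetP=> x GCx def_C; rewrite -(card_cent1_noncentral GCx).
    rewrite -cent1_fibre //; apply: card_commuting_vertex_in.
      by apply/subsetP=> y /setIdP[].
    by move=> u; rewrite c_Some def_C inE (valP u).
  rewrite -card_cent_noncentral; apply: card_commuting_vertex_in.
    by rewrite setSD ?subsetIl.
  move=> u; rewrite c_None; case/setDP: (valP u) => Gu notZu.
  by rewrite in_setD notZu in_setI Gu.
- by case.
move=> u v; rewrite /= /commuting_rel /=; congr (_ && _).
(* The label determines the centralizer: an entry of [enum P] for [Some i], and ['C_G(N)] for
   [None]. *)
rewrite -(eq_cent1_abelian abelian_cent1_noncentral) ?(valP u) ?(valP v) //.
case def_cv: (c v) => [i|].
  by rewrite c_Some; move/eqP: def_cv; rewrite c_Some => /eqP->.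
move/eqP: def_cv; rewrite !c_None => Cv; apply/eqP/idP=> [eqC | Cu].
  apply: contraLR (cent1_notin_cent1s Cv (valP v)) => notCu.
  by rewrite negbK -eqC memP.
by rewrite !cent1_noncentral_normal // (valP u, valP v).
Qed.

End SmallCentralizers.

(** Two vertices are joined by a walk of four possibly stationary steps through the common vertex
    [n]. *)
Lemma commuting_graph_diameter : ~~ small_centralizers ->
  sconnected (commuting_graph G) /\ diameter (commuting_graph G) <= 4.
Proof.
case/common_vertex_near=> n GZn near; apply: lazy_walk_connected => u v.
have lazy (x y : commuting_graph G) :
    commute (val x) (val y) -> (x == y) || sedge x y.
  move=> cxy; rewrite /= /commuting_rel /= -implyNb.
  by apply/implyP=> ->; apply/eqP.
have [y [GZy uy yn]] := near _ (valP u); have [z [GZz vz zn]] := near _ (valP v).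
exists [:: Sub y GZy; Sub n GZn; Sub z GZz; v] => //; split=> //=.
by rewrite !lazy //; apply/commute_sym.
Qed.

End CyclicByAbelian.

(* Connectedness criterion, diameter bound and decomposition *)
Local Close Scope group_scope.

Theorem theorem1p2 (gT : finGroupType) (G A N : {group gT})
    (nonabG : ~~ abelian G)
    (nsNG : (N <| G)%g) (cycN : cyclic N)
    (sAG : A \subset G) (abA : abelian A)
    (defG : (A * N)%g = G) :
  [/\ sconnected (commuting_graph G) <->
        (exists g : gT, [/\ g \in G, g \notin ('Z(G))%g
                          & ~~ abelian ('C_G[g])%g]),
      sconnected (commuting_graph G) -> diameter (commuting_graph G) <= 4
    & ~~ sconnected (commuting_graph G) ->
        sgraph_iso (commuting_graph G)
          (disjoint_union (fun i : option 'I_#|(G^`(1))%g| =>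
             if i is Some _
             then complete_graph (#|G : (G^`(1))%g|%g - #|('Z(G))%g|)
             else complete_graph ((#|(G^`(1))%g| - 1) * #|('Z(G))%g|)))].
Proof.
(* The implications form a cycle: connected gives a nonabelian centralizer, which refutes
   [small_centralizers], which gives connected with diameter at most 4. *)
have ab_small : small_centralizers G N ->
    {in G :\: 'Z(G), forall x, abelian 'C_G[x]}%g.
  by move=> smallC x; apply: abelian_cent1_noncentral defG smallC x.
have notab g : g \in G -> g \notin 'Z(G)%g -> ~~ abelian 'C_G[g]%g ->
    ~~ small_centralizers G N.
  move=> Gg notZg; apply: contra => /ab_small; apply; exact/setDP.
have conn_ab : sconnected (commuting_graph G) ->
    exists g, [/\ g \in G, g \notin 'Z(G) & ~~ abelian 'C_G[g]]%g.
  move=> connG; have [/exists_inP[g /setDP[Gg notZg] nab] | abC] :=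
    boolP [exists g in G :\: 'Z(G), ~~ abelian 'C_G[g]]%g; first by exists g.
  case/negP: nonabG; apply: connected_commuting_abelian connG => x GZx.
  by apply: contraR abC => nab; apply/exists_inP; exists x.
have diam : ~~ small_centralizers G N ->
    sconnected (commuting_graph G) /\ diameter (commuting_graph G) <= 4.
  exact: commuting_graph_diameter defG.
split.
- split=> [/conn_ab // | [g [Gg notZg nab]]].
  by case: (diam (notab g Gg notZg nab)).
- by case/conn_ab=> g [Gg notZg nab]; case: (diam (notab g Gg notZg nab)).
move=> disc; apply: (@commuting_graph_iso _ G A N) => //.
by apply: contraR disc => /diam[].
Qed.
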